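(* A topological group $G$ is skew-amenable if and only if, for every $\theta \in [0,1)$, every neighborhood $U$ of the neutral element in $G$ and every finite subset $E\subseteq G$, there exists a non-empty finite subset $F\subseteq G$ such that $$\forall g \in E \colon \quad \mathrm{match}_{\Lsh}(F,gF,U) \, \geq \, \theta \vert F \vert .$$
   Context: Skew-amenability. For a topological group $G$ and $g\in G$ let $\lambda_g\colon G\to G,\ x\mapsto gx$. Let $\mathrm{LUCB}(G)$ be the algebra of all bounded functions $f\colon G\to\mathbb{R}$ that are left-uniformly continuous, i.e., for every $\epsilon>0$ there is a neighborhood $U$ of the neutral element with $|f(x)-f(y)|\le\epsilon$ whenever $x,y \in G$ and $x^{-1}y\in U$. A mean on $\mathrm{LUCB}(G)$ is a positive linear functional $\mu\colon \mathrm{LUCB}(G)\to\mathbb{R}$ with $\mu(\mathbf 1)=1$. The group $G$ is skew-amenable if $\mathrm{LUCB}(G)$ admits a mean $\mu$ with $\mu(f\circ\lambda_g)=\mu(f)$ for all $f\in\mathrm{LUCB}(G)$, $g\in G$. Matching numbers. For finite subsets $E,F\subseteq G$ and a neighborhood $U$ of the neutral element, $\mathrm{match}_{\Lsh}(E,F,U)$ is the matching number of the bipartite graph with vertex classes $E$ and $F$ (regarded as disjoint) and edge set $\{(x,y)\in E\times F\mid x^{-1}y\in U\}$; that is, the maximum of $|D|$ over all subsets $D\subseteq E$ for which there is an injective map $\phi\colon D\to F$ with $x^{-1}\phi(x)\in U$ for all $x\in D$. Also $gF=\{gx\mid x\in F\}$. *)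

(* Defs.v *)
From HB Require Import structures.
From mathcomp Require Import all_boot all_order all_algebra finmap.
From mathcomp Require Import boolp classical_sets functions reals.
From mathcomp Require Import topology normedtype.

Set Implicit Arguments.
Unset Strict Implicit.
Unset Printing Implicit Defensive.

Import Order.TTheory GRing.Theory Num.Theory.
Import numFieldNormedType.Exports.

Local Open Scope classical_set_scope.
Local Open Scope ring_scope.

(* As in the library's topologicalZmodType, no separation axiom is required. *)
HB.mixin Record isTopologicalGroup G & Topological G & Group G := {
  mulg_continuous : continuous (fun p : G * G => (p.1 * p.2)%g) ;
  invg_continuous : continuous (fun x : G => x^-1%g)
}.

#[short(type="topologicalGroupType")]
HB.structure Definition TopologicalGroup :=
  {G of Topological G & Group G & isTopologicalGroup G}.

Section LUCB.
Variables (R : realType) (G : topologicalGroupType).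

Definition left_uniformly_continuous (f : G -> R) : Prop :=
  forall eps : R, 0 < eps ->
    exists2 U : set G, nbhs (1%g : G) U &
      forall x y : G, U (x^-1 * y)%g -> `|f x - f y| <= eps.

Definition lucb : {pred (G -> R)} :=
  [pred f | `[< bounded_fun f /\ left_uniformly_continuous f >]].

Lemma lucbP (f : G -> R) :
  reflect (bounded_fun f /\ left_uniformly_continuous f) (f \in lucb).
Proof. exact: asboolP. Qed.

Lemma bounded_funP (f : G -> R) :
  bounded_fun f <-> exists M : R, forall x, `|f x| <= M.
Proof.
have PF : ProperFilter (globally [set: G]).
  exact: (@globally_properfilter _ _ (1%g : G)).
split; first by move=> /(@ex_bound _ _ _ _ _ PF)[M /= fM]; exists M => x; exact: fM.
by move=> [M fM]; apply/(@ex_bound _ _ _ _ _ PF); exists M => x _; exact: fM.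
Qed.

Lemma lucb_cst (c : R) : (fun=> c) \in lucb.
Proof.
apply/lucbP; split; first by apply/bounded_funP; exists `|c|.
move=> e e0; exists setT => [|x y _]; first exact: filterT.
by rewrite subrr normr0 ltW.
Qed.

Lemma lucb_submod_closed : submod_closed lucb.
Proof.
split; first exact: (lucb_cst 0).
move=> a f h /lucbP[/bounded_funP[M fM] fU] /lucbP[/bounded_funP[N hN] hU].
apply/lucbP; split.
  apply/bounded_funP; exists (`|a| * M + N) => x /=.
  rewrite (le_trans (ler_normD _ _))// lerD// normrM.
  by rewrite ler_wpM2l.
move=> e e0.
have a0 : 0 < `|a| + 1 by rewrite ltr_wpDl.
have e20 : 0 < e / 2 by rewrite divr_gt0.
have [U U1 fUe] := fU _ (divr_gt0 e20 a0).
have [V V1 hVe] := hU _ e20.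
exists (U `&` V) => [|x y [Uxy Vxy]]; first exact: filterI.
have -> : (a *: f + h) x - (a *: f + h) y = a * (f x - f y) + (h x - h y).
  by rewrite mulrBr opprD addrACA.
rewrite (le_trans (ler_normD _ _))// [leRHS]splitr lerD//; last exact: hVe.
rewrite normrM (@le_trans _ _ ((`|a| + 1) * (e / 2 / (`|a| + 1))))//.
  by rewrite ler_pM// ?lerDl// fUe.
by rewrite mulrC divfK// gt_eqF.
Qed.

HB.instance Definition _ :=
  GRing.isSubmodClosed.Build R (G -> R) lucb lucb_submod_closed.

Record LUCB := MkLUCB { lucb_val :> G -> R ; lucb_valP : lucb_val \in lucb }.

HB.instance Definition _ := [isSub for lucb_val].
HB.instance Definition _ := [Choice of LUCB by <:].
HB.instance Definition _ := [SubChoice_isSubLmodule of LUCB by <:].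

Definition LUCB1 : LUCB := MkLUCB (lucb_cst 1).

Lemma lucb_lambda (g : G) (f : LUCB) : (f \o (fun x => g * x)%g) \in lucb.
Proof.
have /lucbP[/bounded_funP[M fM] fU] := lucb_valP f.
apply/lucbP; split; first by apply/bounded_funP; exists M => x; exact: fM.
move=> e /fU[U U1 fUe]; exists U => // x y Uxy; apply: fUe.
by rewrite invgM -mulgA (mulgA g^-1%g) mulVg mul1g.
Qed.

Definition LUCB_lambda (g : G) (f : LUCB) : LUCB := MkLUCB (lucb_lambda g f).

Definition is_mean (mu : {scalar LUCB}) : Prop :=
  (forall f : LUCB, (forall x, 0 <= f x) -> 0 <= mu f) /\ mu LUCB1 = 1.

Definition skew_amenable : Prop :=
  exists2 mu : {scalar LUCB}, is_mean mu &
    forall (f : LUCB) (g : G), mu (LUCB_lambda g f) = mu f.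

End LUCB.

(* [match] is a Rocq keyword. D ranges over all subsets of E; D and F are
   coerced to the finite types of their elements, so that phi is a map from
   D to F. The index set is never empty, as D = fset0 qualifies. *)
Definition matchnum (G : topologicalGroupType) (E F : {fset G}) (U : set G)
    : nat :=
  \max_(D <- fpowerset E |
        `[< exists2 phi : D -> F, injective phi &
              forall x : D, U ((val x)^-1 * val (phi x))%g >]) #|` D|.

Definition fset_lmul (G : topologicalGroupType) (g : G) (F : {fset G})
    : {fset G} :=
  [fset (g * x)%g | x in F]%fset.

(* Main.v *)
From HB Require Import structures.
Require Import Defs.
From mathcomp Require Import all_boot all_order all_algebra finmap.
From mathcomp Require Import zify lra ring.
From mathcomp Require Import boolp classical_sets cardinality reals.
From mathcomp Require Import ereal constructive_ereal.
From mathcomp Require Import topology normedtype.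

(** From matchings to a mean.  If [F] is matched to [g F] up to [U] on a
    proportion [theta] of its points, the averages of a function [f] in
    [LUCB(G)] over [F] and over [g F] differ by little: matched points
    contribute the oscillation of [f] on [U], unmatched ones at most
    [2 (1 - theta)] times the bound of [f] ([average_translate]).  As the
    matching condition survives when finitely many triples [(theta, U, E)] are
    imposed together, an ultrafilter refines all of them, and the limit of the
    averages along it is an invariant mean ([has_matchings_skew_amenable]).

    From a mean to matchings.  Fix [W], [E] and [eta > 0], and a left-uniform
    pseudometric [d] whose unit balls are contained in the translates of [W].
    Suppose that no finite family [x_1, ..., x_n] (repetitions allowed) is
    matched within [W] to [g x_1, ..., g x_n], for all [g] in [E], outside a
    proportion [eta] of the indices.  By the deficiency form of Hall's theorem
    ([hall_deficiency]) each family has, for some [g] in [E], a set [S] of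
    indices with fewer than [#|S| - eta n] neighbors, and a bump function
    around [S], which is [d]-Lipschitz with values in [[0, 1]], satisfies
    [sum_i (f (x_i) - f (g x_i)) >= eta n]
    ([index_matching_obstruction]).  Thus, against every family of points,
    some tuple [(F_h)_{h in E}] in the convex, pointwise compact set of tuples
    of such functions has average drift [sum_h (F_h a - F_h (h a))] at least
    [eta].  A minimax argument turns this into a single tuple whose drift is
    at least [eta / 2] at every point [a]: over finitely many points by
    Blackwell's approachability ([approachability]), which copes with integer
    weights, then over all of [G] by a limit along an ultrafilter
    ([uniform_drift]).  An invariant mean gives the drift the value [0], a
    contradiction.  Compactness is what makes the estimate uniform over the
    infinitely many bump functions, which weak convergence of finitely
    supported means would not provide.

    It remains to pass from families to sets.  If all neighborhoods of [1] are
    infinite, right multiplication of the [x_i] by small distinct elements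
    makes them distinct; this commutes with left translation and costs only a
    smaller neighborhood ([index_matching_infinite]).  Otherwise [1] has a
    smallest neighborhood [N], a finite subgroup, and a family gives a
    function counting its members in each coset [y N]; one of the superlevel
    sets of that function is almost invariant, by the layer-cake argument of
    Namioka ([index_matching_finite]). *)

Set Implicit Arguments.
Unset Strict Implicit.
Unset Printing Implicit Defensive.

Import Order.TTheory GRing.Theory Num.Theory.
Import numFieldNormedType.Exports.

Local Open Scope classical_set_scope.
Local Open Scope ring_scope.

(** * Left-uniform pseudometrics *)

Section Neighborhoods.
Variable G : topologicalGroupType.
Implicit Types (U V : set G) (x y z : G).

Lemma nbhs1_mulg U : nbhs (1%g : G) U ->
  exists2 V, nbhs (1%g : G) V & forall x y, V x -> V y -> U (x * y)%g.
Proof.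
move=> U1.
have := @mulg_continuous G (1%g, 1%g); rewrite /= /continuous_at mulg1.
move=> /(_ U U1)[[A B] /= [A1 B1] AB].
exists (A `&` B); first exact: filterI.
by move=> x y [Ax _] [_ By]; exact: (AB (x, y)).
Qed.

Lemma nbhs1_invg U : nbhs (1%g : G) U ->
  nbhs (1%g : G) [set x | U x^-1%g].
Proof.
move=> U1; have := @invg_continuous G 1%g; rewrite /continuous_at invg1.
exact.
Qed.

End Neighborhoods.

(** A copy of the group, to carry the left uniformity. *)
Definition left_uniform (G : topologicalGroupType) : Type := G.

Definition pseudometric (R : numDomainType) (T : Type) (d : T -> T -> R) :=
  [/\ forall x, d x x = 0, forall x y, 0 <= d x y,
      forall x y, d x y = d y x & forall x y z, d x z <= d x y + d y z].

Definition left_uniform_pseudometric (R : numDomainType)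
    (G : topologicalGroupType) (d : G -> G -> R) :=
  forall e, 0 < e -> exists2 U, nbhs (1%g : G) U &
    forall x y, U (x^-1 * y)%g -> d x y <= e.

Section LeftUniformity.
Variable G : topologicalGroupType.

Definition left_entourage : set_system (left_uniform G * left_uniform G) :=
  filter_from (nbhs (1%g : G))
    (fun U => [set p | U ((p.1 : G)^-1 * (p.2 : G))%g]).

Local Open Scope relation_scope.

Lemma left_entourage_filter : Filter left_entourage.
Proof.
apply: filter_from_filter; first by exists setT; exact: filterT.
by move=> U V U1 V1; exists (U `&` V); first exact: filterI.
Qed.

Lemma left_entourage_refl A : left_entourage A -> diagonal `<=` A.
Proof.
move=> [U U1 UA] [x y] /= /diagonalP ->; apply: UA => /=.
by rewrite mulVg; exact: nbhs_singleton.
Qed.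

Lemma left_entourage_inv A : left_entourage A -> left_entourage A^-1.
Proof.
move=> [U U1 UA]; exists [set x | U x^-1%g]; first exact: nbhs1_invg.
by move=> [x y] /=; rewrite invgM invgK => Uxy; exact: UA.
Qed.

Lemma left_entourage_split A :
  left_entourage A -> exists2 B, left_entourage B & B \; B `<=` A.
Proof.
move=> [U /nbhs1_mulg[V V1 VU] UA].
exists [set p | V ((p.1 : G)^-1 * (p.2 : G))%g]; first by exists V.
move=> [x z] /= [y /= Vxy Vyz]; apply: UA => /=.
by have := VU _ _ Vxy Vyz; rewrite -mulgA mulVKg.
Qed.

HB.instance Definition _ := Choice.on (left_uniform G).
HB.instance Definition _ := @isUniform.Build (left_uniform G) left_entourage
  left_entourage_filter left_entourage_refl left_entourage_inv
  left_entourage_split.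

(** The left uniformity contains the entourage given by [W], and the countable
    uniformity generated by one entourage is metrizable. *)
Lemma left_pseudometric (R : realType) (W : set G) : nbhs (1%g : G) W ->
  exists d : G -> G -> R,
    [/\ pseudometric d, left_uniform_pseudometric d &
        forall x y, d x y < 1 -> W (x^-1 * y)%g].
Proof.
move=> W1.
pose E : set (left_uniform G * left_uniform G) :=
  [set p | W ((p.1 : G)^-1 * (p.2 : G))%g].
have entE : entourage E by exists W.
pose T : pseudoMetricType R := gauge.type entE.
have Tfin (p : T * T) : @edist R T p \is a fin_num.
  apply/edist_finP; exists 2 => //.
  exact: countable_uniform.countable_uniform_bounded.
(* The metrized uniformity has [E] among its entourages, so a ball is inside. *)
have : @entourage T E by exists 0%N => // ? [].
rewrite -entourage_ballE => -[e /= e0 eE].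
pose d (x y : T) : R := fine (edist (x, y)) / e.
exists d; split.
- split=> [x|x y|x y|x y z].
  + by rewrite /d edist_refl mul0r.
  + by rewrite divr_ge0 ?(ltW e0)// fine_ge0// edist_ge0.
  + by rewrite /d edist_sym.
  + rewrite /d -mulrDl ler_pM2r ?invr_gt0// -fineD// fine_le//.
      by rewrite fin_numD !Tfin.
    exact: edist_triangle.
- move=> r r0; have : @entourage T [set p | ball p.1 (r * e) p.2].
    by rewrite -entourage_ballE; exists (r * e) => //=; rewrite mulr_gt0.
  move=> /(gauge.gauge_ent entE)[U U1 UB]; exists U => // x y Uxy.
  rewrite ler_pdivrMr// -lee_fin fineK//; apply: edist_fin.
    by rewrite mulr_gt0.
  exact: (UB (x, y)).
- move=> x y; rewrite ltr_pdivrMr// mul1r -lte_fin fineK// => dxy.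
  by apply: (eE (x, y)); exact: (@edist_lt_ball R T _ (x, y)).
Qed.

End LeftUniformity.

(** * Hall's theorem with a deficiency *)

Section DeficiencyHall.
Variables A B : finType.
Implicit Types (N : A -> {set B}) (S : {set A}) (d : nat).

Definition neighbors N S : {set B} := \bigcup_(a in S) N a.

Definition hall_condition d N :=
  forall S, (#|S| <= #|neighbors N S| + d)%N.

Let erase N a b : A -> {set B} := fun x => if x == a then N x :\ b else N x.

(** If both erasures violated the condition, at [S1] and at [S2], then both
    sets contain [a], and submodularity of [S |-> #|neighbors N S|] gives a
    violation of the original condition at [S1 :|: S2] or at
    [(S1 :&: S2) :\ a]. *)
Lemma hall_condition_erase d N a b1 b2 :
    hall_condition d N -> b1 != b2 ->
  hall_condition d (erase N a b1) \/ hall_condition d (erase N a b2).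
Proof.
move=> hallN b12; apply: contrapT => /not_orP[].
move=> /existsNP[S1 /negP]; rewrite -ltnNge => lt1.
move=> /existsNP[S2 /negP]; rewrite -ltnNge => lt2.
have aS S b : (#|neighbors (erase N a b) S| + d < #|S|)%N -> a \in S.
  apply: contraTT => aS; rewrite -leqNgt.
  suff -> : neighbors (erase N a b) S = neighbors N S by exact: hallN.
  apply: eq_bigr => x xS; rewrite /erase; case: eqP => // xa.
  by rewrite -xa xS in aS.
have aS1 := aS _ _ lt1; have aS2 := aS _ _ lt2.
have subU : neighbors N (S1 :|: S2) \subset
    neighbors (erase N a b1) S1 :|: neighbors (erase N a b2) S2.
  apply/fintype.subsetP => y /bigcupP[x]; rewrite inE => xS Ny.
  rewrite inE; have [xa|xa] := eqVneq x a.
    have [yb|yb] := eqVneq y b1.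
      apply/orP; right; apply/bigcupP; exists a => //.
      by rewrite /erase eqxx !inE yb b12 -xa -yb.
    apply/orP; left; apply/bigcupP; exists a => //.
    by rewrite /erase eqxx !inE yb -xa.
  case/orP: xS => xS; apply/orP; [left|right]; apply/bigcupP; exists x => //;
    by rewrite /erase (negbTE xa).
have subI : neighbors N ((S1 :&: S2) :\ a) \subset
    neighbors (erase N a b1) S1 :&: neighbors (erase N a b2) S2.
  apply/fintype.subsetP => y /bigcupP[x]; rewrite !inE => /and3P[xa x1 x2] Ny.
  by apply/andP; split; apply/bigcupP; exists x => //;
    rewrite /erase (negbTE xa).
have leU := leq_trans (hallN _) (leq_add (subset_leq_card subU) (leqnn d)).
have leI := leq_trans (hallN _) (leq_add (subset_leq_card subI) (leqnn d)).
have := cardsUI S1 S2.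
have := cardsUI (neighbors (erase N a b1) S1) (neighbors (erase N a b2) S2).
have := cardsD1 a (S1 :&: S2); rewrite inE aS1 aS2 /=.
by lia.
Qed.

(** Edges can be erased while some [N a] has two elements
    ([hall_condition_erase]).  Once all have at most one, the condition for
    the full set says that the union of the [N a] has at least [#|A| - d]
    elements, and one preimage of each of them gives the matching.  [b0] is a
    default value. *)
Lemma hall_deficiency (b0 : B) d N : hall_condition d N ->
  exists (D : {set A}) (f : A -> B),
    [/\ {in D &, injective f}, forall a, a \in D -> f a \in N a &
        (#|A| <= #|D| + d)%N].
Proof.
have [m] := ubnP (\sum_a #|N a|)%N; elim: m N => // m IHm N.
rewrite ltnS => ltm hallN.
have [/existsP[a /card_gt1P[b1 [b2 [Nb1 Nb2 b12]]]]|] :=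
    boolP [exists a, (1 < #|N a|)%N].
  have erase_smaller b : b \in N a -> hall_condition d (erase N a b) ->
      exists (D : {set A}) (f : A -> B),
      [/\ {in D &, injective f}, forall a, a \in D -> f a \in N a &
      (#|A| <= #|D| + d)%N].
    move=> Nb /IHm[|D [f [injf fN cD]]].
      apply: leq_trans (ltm : (_ <= m)%N).
      rewrite (bigD1 a)//= [ltnRHS](bigD1 a)//= /erase eqxx.
      rewrite (cardsD1 b (N a)) Nb add1n ltnS leq_add2l.
      by apply: leq_sum => x /negbTE ->.
    exists D, f; split=> // x xD; have := fN x xD.
    by rewrite /erase; case: ifP => // _ /setD1P[].
  by have [] := hall_condition_erase a hallN b12; exact: erase_smaller.
rewrite negb_exists => /forallP N1.
have {}N1 a b b' : b \in N a -> b' \in N a -> b = b'.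
  by have := N1 a; rewrite -leqNgt => /card_le1_eqP H ? ?; exact: H.
pose h (b : B) : option A := [pick a | b \in N a].
pose D : {set A} := [set a | [exists b, h b == Some a]]%SET.
pose f a := odflt b0 [pick b | h b == Some a].
have fP a : a \in D -> h (f a) = Some a.
  rewrite inE => /existsP[b hb]; rewrite /f.
  by case: pickP => [b' /eqP //|/(_ b)]; rewrite hb.
have hP b a : h b = Some a -> b \in N a.
  by rewrite /h; case: pickP => // x ? [<-].
exists D, f; split.
- by move=> a a' aD a'D ff; have := fP _ aD; rewrite ff fP// => -[].
- by move=> a /fP/hP.
- have := hallN [set: A]%SET; rewrite cardsT => /leq_trans; apply.
  rewrite leq_add2r.
  suff sub : neighbors N [set: A]%SET \subset [set f a | a in D]%SET.
    exact: leq_trans (subset_leq_card sub) (leq_imset_card _ _).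
  apply/fintype.subsetP => b /bigcupP[a _ Nab].
  have [a' hb] : exists a', h b = Some a'.
    by rewrite /h; case: pickP => [x _|/(_ a)]; [exists x|rewrite Nab].
  have a'D : a' \in D by rewrite inE; apply/existsP; exists b; rewrite hb.
  apply/imsetP; exists a' => //.
  by apply: (N1 a'); apply: hP; rewrite ?fP.
Qed.

End DeficiencyHall.

(** * Approachability *)

Section Approachability.
Variables (R : realType) (I : finType) (X : Type) (Z : set X).
Variables (K : X -> I -> R) (B eta : R).
Hypothesis K_bounded : forall z i, Z z -> `|K z i| <= B.

Let pos (r : R) : R := Num.max 0 r.

Let pos_sqrD (a b : R) :
  pos (a + b) ^+ 2 <= pos a ^+ 2 + 2 * (pos a * b) + b ^+ 2.
Proof.
have -> : pos a ^+ 2 + 2 * (pos a * b) + b ^+ 2 = (pos a + b) ^+ 2 by ring.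
have pa0 : 0 <= pos a by rewrite /pos le_max lexx.
have apa : a <= pos a by rewrite /pos le_max lexx orbT.
rewrite {1}/pos; case: (leP 0 (a + b)) => [ab0|_].
  by rewrite ler_sqr ?nnegrE; lra.
by rewrite expr0n sqr_ge0.
Qed.

(** Blackwell's strategy: at each time answer the weights given by the integer
    parts of the current shortfalls [eta t - sum_(k < t) K (s k) i], where
    positive.  The sum of the squares of the positive shortfalls then grows
    at most linearly in time, so that the average shortfalls tend to [0].
    Only integer weights have to be answered: rounding them changes the
    increment of the potential by a bounded amount. *)
Lemma approachability :
    (forall w : I -> nat, exists2 z, Z z &
      eta * \sum_i (w i)%:R <= \sum_i (w i)%:R * K z i) ->
  exists2 s : nat -> X, (forall t, Z (s t)) &
    forall delta, 0 < delta -> exists2 n, (0 < n)%N &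
      forall i, (eta - delta) * n%:R <= \sum_(t < n) K (s t) i.
Proof.
move=> exists_best.
have /choice[best bestP] : forall w : I -> nat, exists z,
    Z z /\ eta * \sum_i (w i)%:R <= \sum_i (w i)%:R * K z i.
  by move=> w; have [z Zz Kz] := exists_best w; exists z.
have best_mem w : Z (best w) by have [] := bestP w.
have bestK w : eta * \sum_i (w i)%:R <= \sum_i (w i)%:R * K (best w) i.
  by have [] := bestP w.
pose wt (v : I -> R) i := Num.truncn (pos (v i)).
pose v := fix v t : I -> R :=
  if t is t'.+1 then fun i => v t' i + (eta - K (best (wt (v t'))) i)
  else fun=> 0.
pose s t := best (wt (v t)).
have vE t i : v t i = eta * t%:R - \sum_(k < t) K (s k) i.
  elim: t => [|t IH]; first by rewrite /= big_ord0 mulr0 subr0.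
  by rewrite /= IH big_ord_recr/= -natr1 -/(s t); ring.
pose c := `|eta| + `|B|.
have c0 : 0 <= c by rewrite addr_ge0.
pose k := 2 * c + c ^+ 2.
have k0 : 0 <= k by rewrite addr_ge0 ?mulr_ge0 ?sqr_ge0.
pose C : R := #|I|%:R * k.
have potential t : \sum_i pos (v t i) ^+ 2 <= C * t%:R.
  elim: t => [|t IH].
    by rewrite mulr0 big1// => i _; rewrite /= /pos maxxx expr0n.
  rewrite -natr1 mulrDr mulr1.
  pose b i := eta - K (s t) i.
  have bc i : `|b i| <= c.
    rewrite (le_trans (ler_normB _ _))// lerD2l.
    rewrite (le_trans (K_bounded _ (best_mem _)))//.
    exact: ler_norm.
  have step i : pos (v t.+1 i) ^+ 2 <=
      pos (v t i) ^+ 2 + 2 * ((wt (v t) i)%:R * b i) + k.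
    apply: le_trans (pos_sqrD _ _) _; rewrite -/(s t) -/(b i).
    have p0 : 0 <= pos (v t i) by rewrite /pos le_max lexx.
    have /andP[w1 w2] := truncn_itv p0; rewrite -natr1 in w2.
    have b2 : b i ^+ 2 <= c ^+ 2.
      by rewrite -real_normK ?num_real// ler_sqr ?nnegrE.
    suff : (pos (v t i) - (wt (v t) i)%:R) * b i <= c by rewrite mulrBl /k; lra.
    rewrite (le_trans (ler_norm _))// normrM -[leRHS]mul1r ler_pM//.
    by rewrite ler_norml; apply/andP; split; rewrite /wt; lra.
  apply: le_trans (ler_sum _ (fun i _ => step i)) _.
  have -> : \sum_i (pos (v t i) ^+ 2 + 2 * ((wt (v t) i)%:R * b i) + k) =
      \sum_i pos (v t i) ^+ 2 + \sum_i 2 * ((wt (v t) i)%:R * b i) + C.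
    by rewrite big_split/= big_split/= sumr_const -[k *+ _]mulr_natl.
  rewrite lerD2r.
  rewrite -[leRHS]addr0 lerD// -mulr_sumr pmulr_rle0//.
  under eq_bigr do rewrite mulrBr.
  rewrite sumrB -mulr_suml subr_le0 mulrC; exact: bestK.
exists s => [t|delta d0]; first exact: best_mem.
have C0 : 0 <= C by rewrite mulr_ge0.
(* The time at which [C n <= (delta n) ^ 2]. *)
pose n := (Num.truncn (C / delta ^+ 2)).+1.
have n0 : 0 < n%:R :> R by rewrite ltr0n.
have Cn : C < n%:R * delta ^+ 2.
  rewrite -ltr_pdivrMr ?exprn_gt0//.
  by have /andP[] := truncn_itv (divr_ge0 C0 (sqr_ge0 delta)).
exists n => // i.
suff : pos (v n i) <= delta * n%:R.
  rewrite /pos ge_max => /andP[_]; rewrite vE; lra.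
have p0 : 0 <= pos (v n i) by rewrite /pos le_max lexx.
rewrite -ler_sqr ?nnegrE ?mulr_ge0 ?(ltW d0) ?(ltW n0)//.
apply: le_trans (_ : C * n%:R <= _); last first.
  by rewrite exprMn (expr2 n%:R) mulrA ler_pM2r// mulrC ltW.
apply: le_trans (potential n).
by rewrite (bigD1 i)//= lerDl sumr_ge0// => j _; rewrite sqr_ge0.
Qed.

End Approachability.

(** * Limits along ultrafilters *)

(** Bounded functions converge along an ultrafilter, by compactness of closed
    bounded intervals. *)
Lemma ultralimit (R : realType) (T : Type) (F : set_system T) :
  ProperFilter F ->
  exists L : (T -> R) -> R,
    [/\ forall (a : R) (u v : T -> R) (M N : R),
          (forall t, `|u t| <= M) -> (forall t, `|v t| <= N) ->
          L (fun t => a * u t + v t) = a * L u + L v,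
        forall (u : T -> R) (M c : R), (forall t, `|u t| <= M) ->
          (\forall t \near F, c <= u t) -> c <= L u &
        forall (u : T -> R) (M c : R), (forall t, `|u t| <= M) ->
          (\forall t \near F, u t <= c) -> L u <= c].
Proof.
move=> /ultraFilterLemma[U [UU FU]].
have cvgU (u : T -> R) M : (forall t, `|u t| <= M) -> cvg (u @ U).
  move=> uM; have := @segment_compact R (- M) M.
  move=> /(_ (u @ U) _)[].
    by apply: (@filterE _ U) => t /=; rewrite in_itv /= -ler_norml uM.
  move=> l [_ ul]; apply/cvg_ex; exists l => B Bl.
  have [//|uB] := in_ultra_setVsetC (u @^-1` B) UU.
  have : (u @ U) (~` B) by [].
  by move=> /ul /(_ Bl)[x []].
exists (fun u => lim (u @ U)); split.
- move=> a u v M N /cvgU ul /cvgU vl.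
  by have /(_ _ _ _)/cvg_lim -> := cvgD (cvgM (cvg_cst a) ul) vl.
- by move=> u M c /cvgU ul /FU cu; exact: (limr_ge ul).
- by move=> u M c /cvgU ul /FU cu; exact: (limr_le ul).
Qed.

(** * Matching numbers *)

Section MatchingNumbers.
Variable G : topologicalGroupType.
Implicit Types (E F D : {fset G}) (U V : set G) (k : nat).

(** Replaces maps between the finite types of elements of [D] and [F] by maps
    of the ambient group. *)
Lemma matchnum_geP E F U k :
  (k <= matchnum E F U)%N <->
  exists (D : {fset G}) (f : G -> G),
    [/\ (D `<=` E)%fset, {in D &, injective f},
        forall x, x \in D -> f x \in F /\ U (x^-1 * f x)%g &
        (k <= #|` D|)%N].
Proof.
split=> [kEF|[D [f [DE injf fP kD]]]]; last first.
  rewrite (leq_trans kD)// /matchnum.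
  apply: (@leq_bigmax_seq _ _ _ (fun D : {fset G} => #|` D|)).
    by rewrite fpowersetE.
  apply/asboolP.
  have fF (x : D) : f (val x) \in F by have [] := fP _ (valP x).
  exists (fun x : D => [` fF x]%fset).
    by move=> x y /(congr1 val)/= /injf xy; apply/val_inj/xy; exact: valP.
  by move=> x /=; have [] := fP _ (valP x).
apply: contrapT => noD; move: kEF; apply/negP; rewrite -ltnNge.
have k0 : (0 < k)%N.
  rewrite lt0n; apply/eqP => k0; apply: noD; exists fset0, id.
  by split; rewrite ?fsub0set ?k0// => x; rewrite inE.
rewrite -(prednK k0) ltnS /matchnum.
apply/bigmax_leqP_seq => D; rewrite fpowersetE => DE /asboolP[phi injphi phiU].
rewrite -ltnS (prednK k0) ltnNge; apply/negP => kD; apply: noD.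
pose f x := if insub x is Some u then val (phi u) else x.
have fE x (xD : x \in D) : f x = val (phi [` xD]%fset) by rewrite /f insubT.
exists D, f; split => //.
  move=> x y xD yD; rewrite !fE => /val_inj/injphi.
  by move=> /(congr1 val).
by move=> x xD; rewrite fE; split; [exact: valP|exact: (phiU [` xD]%fset)].
Qed.

Lemma matchnumS E F U V : U `<=` V -> (matchnum E F U <= matchnum E F V)%N.
Proof.
move=> UV; apply/matchnum_geP.
have /matchnum_geP[D [f [DE injf fP cD]]] := leqnn (matchnum E F U).
by exists D, f; split=> // x /fP[]; split=> //; exact: UV.
Qed.

End MatchingNumbers.

Section MatchnumOfFamilies.
Variable G : topologicalGroupType.
Implicit Types (E F : {fset G}) (U : set G).

Lemma matchnum_ge_family (I : finType) (D : {set I}) (a b : I -> G) E F U :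
    {in D &, injective a} -> {in D &, injective b} ->
    (forall i, i \in D -> [/\ a i \in E, b i \in F & U ((a i)^-1 * b i)%g]) ->
  (#|D| <= matchnum E F U)%N.
Proof.
move=> inja injb abP; apply/matchnum_geP.
pose f z := if [pick i in D | a i == z] is Some i then b i else z.
have fa i : i \in D -> f (a i) = b i.
  move=> iD; rewrite /f; case: pickP => [j /andP[jD /eqP /inja ->//]|/(_ i)].
  by rewrite iD eqxx.
exists [fset a i | i in D]%fset, f; split.
- by apply/fsubsetP => _ /imfsetP[i /= iD ->]; have [] := abP i iD.
- move=> _ _ /imfsetP[i /= iD ->] /imfsetP[j /= jD ->].
  by rewrite !fa// => /injb ->.
- by move=> _ /imfsetP[i /= iD ->]; rewrite fa//; have [] := abP i iD.
- by rewrite card_in_imfset//= cardE.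
Qed.

End MatchnumOfFamilies.

(** * Invariant means from matchings *)

Section Averages.
Variables (R : realType) (T : choiceType).
Implicit Types (A D F : {fset T}) (f : T -> R).

Definition average F f : R := (\sum_(x <- F) f x) / #|` F|%:R.

Lemma card_fset_gt0 F : F != fset0 -> 0 < #|` F|%:R :> R.
Proof. by move=> F0; rewrite ltr0n cardfs_gt0. Qed.

Lemma ler_norm_sum_fset F f (c : R) :
  (forall x, x \in F -> `|f x| <= c) -> `|\sum_(x <- F) f x| <= c * #|` F|%:R.
Proof.
move=> fc; rewrite big_seq_fsetE (le_trans (ler_norm_sum _ _ _))//.
rewrite cardfE mulr_natr -sumr_const; apply: ler_sum => x _.
by apply: fc; exact: valP.
Qed.

Lemma average_bounded F f (M : R) : 0 <= M -> (forall x, `|f x| <= M) ->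
  `|average F f| <= M.
Proof.
move=> M0 fM; have [->|/card_fset_gt0 F0] := eqVneq F fset0.
  by rewrite /average cardfs0 invr0 mulr0 normr0.
rewrite /average normrM normfV (gtr0_norm F0) ler_pdivrMr//.
by apply: ler_norm_sum_fset => x _; exact: fM.
Qed.

Lemma sum_fset_le F D f (M : R) : (D `<=` F)%fset -> (forall x, `|f x| <= M) ->
  `|\sum_(x <- F) f x - \sum_(x <- D) f x| <= M * (#|` F|%:R - #|` D|%:R).
Proof.
move=> DF fM; rewrite (big_fsetID _ (mem D) F) /=.
rewrite (_ : [fset x in F | x \in D]%fset = D); last first.
  by apply/fsetP => x; rewrite !inE /= andb_idl// => /(fsubsetP DF).
rewrite (_ : [fset x in F | x \notin D]%fset = (F `\` D)%fset); last first.
  by apply/fsetP => x; rewrite !inE /= andbC.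
rewrite addrAC subrr add0r -natrB ?fsubset_leq_card// -cardfsDS//.
by apply: ler_norm_sum_fset => x _; exact: fM.
Qed.

End Averages.

Section AverageTranslate.
Variables (R : realType) (G : topologicalGroupType).
Implicit Types (F : {fset G}) (U : set G) (f : G -> R).

(** The sum over [F] of the translate is the sum of [f] over [g F].  Matched
    pairs cost [e] each; the unmatched points of [F] and of [g F] cost [M]
    each. *)
Lemma average_translate F U f (g : G) (theta M e : R) :
    F != fset0 -> 0 <= e -> (forall x, `|f x| <= M) ->
    (forall x y, U (x^-1 * y)%g -> `|f x - f y| <= e) ->
    theta * #|` F|%:R <= (matchnum F (fset_lmul g F) U)%:R ->
  `|average F (fun x => f (g * x)%g) - average F f| <=
    e + 2 * M * (1 - theta).
Proof.
move=> F0 e0 fM fU thetaF; have c0 := card_fset_gt0 R F0.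
have [D [h [DF injh hP cD]]] := (matchnum_geP _ _ _ _).1 (leqnn
  (matchnum F (fset_lmul g F) U)).
have {}thetaF : theta * #|` F|%:R <= #|` D|%:R.
  by apply: le_trans thetaF _; rewrite ler_nat.
rewrite /average -mulrBl normrM normfV (gtr0_norm c0) ler_pdivrMr//.
have injg : injective (fun x : G => (g * x)%g) by exact: mulgI.
have -> : \sum_(x <- F) f (g * x)%g = \sum_(y <- fset_lmul g F) f y.
  by rewrite big_imfset//= => x y _ _; exact: injg.
have cg : #|` fset_lmul g F| = #|` F| by rewrite card_imfset.
pose hD := [fset h x | x in D]%fset.
have chD : #|` hD| = #|` D| by rewrite card_in_imfset.
have sub : (hD `<=` fset_lmul g F)%fset.
  by apply/fsubsetP => y /imfsetP[x /= xD ->]; have [] := hP x xD.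
have d1 := sum_fset_le sub fM; rewrite chD cg in d1.
have d2 := sum_fset_le DF fM.
have d3 : `|\sum_(y <- hD) f y - \sum_(x <- D) f x| <= e * #|` D|%:R.
  rewrite big_imfset//= -sumrB; apply: ler_norm_sum_fset => x xD.
  by rewrite distrC; apply: fU; have [] := hP x xD.
have dF : #|` D|%:R <= #|` F|%:R :> R by rewrite ler_nat fsubset_leq_card.
have eD : e * #|` D|%:R <= e * #|` F|%:R by rewrite ler_wpM2l.
have M0 : 0 <= M := le_trans (normr_ge0 _) (fM 1%g).
have MD : M * (#|` F|%:R - #|` D|%:R) <= M * ((1 - theta) * #|` F|%:R).
  by rewrite ler_wpM2l//; lra.
move: d1 d2 d3; rewrite !ler_norml => /andP[? ?] /andP[? ?] /andP[? ?].
by apply/andP; split; lra.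
Qed.

End AverageTranslate.

Section MeanFromMatchings.
Variables (R : realType) (G : topologicalGroupType).

Definition has_matchings := forall (theta : R) (U : set G) (E : {fset G}),
  0 <= theta < 1 -> nbhs (1%g : G) U ->
  exists2 F : {fset G}, F != fset0 &
    forall g : G, g \in E ->
      theta * (#|` F|)%:R <= (matchnum F (fset_lmul g F) U)%:R.

(** The nonempty finite sets for which the matching condition holds at
    [(theta, U, E)] decrease when [theta] and [E] increase and [U] decreases;
    an average over [F] becomes invariant along this filter. *)
Definition matching_filter : set_system {fset G} :=
  filter_from [set i : R * set G * {fset G} |
                0 <= i.1.1 < 1 /\ nbhs (1%g : G) i.1.2]
    (fun i => [set F | F != fset0 /\ forall g, g \in i.2 ->
      i.1.1 * (#|` F|)%:R <= (matchnum F (fset_lmul g F) i.1.2)%:R]).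

Lemma matching_filter_proper :
  has_matchings -> ProperFilter matching_filter.
Proof.
move=> matchings; apply: filter_from_proper; last first.
  move=> [[theta U] E] /= [theta01 U1].
  by have [F F0 FE] := matchings theta U E theta01 U1; exists F.
apply: filter_from_filter.
  exists (0, setT, fset0); split => /=; first by rewrite lexx ltr01.
  exact: filterT.
move=> [[t U] E] [[t' U'] E'] /= [/andP[t0 t1] U1] [/andP[t'0 t'1] U'1].
exists (Num.max t t', U `&` U', (E `|` E')%fset) => /=.
  by split; [rewrite le_max t0 gt_max t1 t'1|exact: filterI].
move=> F /= [F0 FE]; split; split=> // g gE.
  apply: le_trans (_ : _ <= (matchnum F (fset_lmul g F) (U `&` U'))%:R) _.
    apply: le_trans (FE g _); last by rewrite inE gE.
    by rewrite ler_wpM2r// le_max lexx.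
  by rewrite ler_nat; apply: matchnumS => x [].
apply: le_trans (_ : _ <= (matchnum F (fset_lmul g F) (U `&` U'))%:R) _.
  apply: le_trans (FE g _); last by rewrite inE gE orbT.
  by rewrite ler_wpM2r// le_max lexx orbT.
by rewrite ler_nat; apply: matchnumS => x [].
Qed.

(** The mean is the limit of the averages along an ultrafilter that refines
    [matching_filter]. *)
Lemma has_matchings_skew_amenable : has_matchings -> skew_amenable R G.
Proof.
move=> /matching_filter_proper PF.
have [L [L_lin L_ge L_le]] := @ultralimit R _ _ PF.
have nonempty : \forall F \near matching_filter, F != fset0.
  exists (0, setT, fset0); last by move=> F [].
  by split=> /=; [rewrite lexx ltr01|exact: filterT].
have avgM (f : LUCB R G) :
    exists2 M, (forall x, `|f x| <= M) & forall F, `|average F f| <= M.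
  have /lucbP[/Defs.bounded_funP[M fM] _] := lucb_valP f.
  exists M => // F; apply: average_bounded => //.
  exact: le_trans (normr_ge0 _) (fM 1%g).
pose mu0 (f : LUCB R G) : R := L (fun F => average F f).
have mu0_lin : scalar mu0.
  move=> a f h; have [M _ fM] := avgM f; have [N _ hN] := avgM h.
  rewrite /mu0 -(L_lin _ _ _ _ _ fM hN); congr L; apply/funext => F.
  rewrite /average mulrA -mulrDl; congr (_ / _).
  by rewrite big_distrr /= -big_split.
pose mu : {scalar LUCB R G} :=
  HB.pack mu0 (GRing.isLinear.Build R (LUCB R G) R _ mu0 mu0_lin).
exists mu; first split.
- move=> f f0; have [M _ fM] := avgM f; apply: L_ge fM _.
  apply: filterE => F; rewrite divr_ge0// big_seq_fsetE sumr_ge0//.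
- have [M _ oneM] := avgM (LUCB1 R G).
  have avg1 : \forall F \near matching_filter, average F (LUCB1 R G) = 1.
    apply: filterS nonempty => F /(card_fset_gt0 R) F0.
    rewrite /average big_seq_fsetE /= sumr_const -cardfE divff//.
    by rewrite gt_eqF.
  apply/eqP; rewrite eq_le; apply/andP; split.
    by apply: L_le oneM _; apply: filterS avg1 => F ->.
  by apply: L_ge oneM _; apply: filterS avg1 => F ->.
- move=> f g; apply/eqP; rewrite -subr_eq0 -normr_le0.
  apply/ler_addgt0Pl => r r0; rewrite addr0.
  have [M fM avgfM] := avgM f; have [N _ avgN] := avgM (LUCB_lambda g f).
  have M0 : 0 <= M by exact: le_trans (normr_ge0 _) (fM 1%g).
  have /lucbP[_ fU] := lucb_valP f.
  have r20 : 0 < r / 2 by rewrite divr_gt0.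
  have [U U1 {}fU] := fU _ r20.
  (* With [theta = 1 - t] unmatched points cost at most [2 M t <= r / 2]. *)
  pose t := r / (4 * M + 2 * r).
  have den0 : 0 < 4 * M + 2 * r by rewrite ltr_wpDl ?mulr_ge0 ?mulr_gt0.
  have t0 : 0 < t by rewrite divr_gt0.
  have t1 : t <= 1 by rewrite ler_pdivrMr// mul1r; lra.
  have Mt : 2 * M * t <= r / 2.
    by rewrite mulrA ler_pdivrMr//; nra.
  have diff_small : \forall F \near matching_filter,
      `|-1 * average F f + average F (LUCB_lambda g f)| <= r.
    exists (1 - t, U, [fset g]%fset) => /=.
      by split => //=; apply/andP; split; lra.
    move=> F /= [F0 /(_ g)]; rewrite inE eqxx => /(_ isT) thetaF.
    have := average_translate F0 (ltW r20) fM fU thetaF.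
    by rewrite mulN1r addrC /=; lra.
  have bd F : `|-1 * average F f + average F (LUCB_lambda g f)| <= M + N.
    by rewrite (le_trans (ler_normD _ _))// lerD// mulN1r normrN.
  have -> : mu (LUCB_lambda g f) - mu f =
      L (fun F => -1 * average F f + average F (LUCB_lambda g f)).
    by rewrite (L_lin _ _ _ _ _ avgfM avgN) mulN1r addrC.
  rewrite ler_norml; apply/andP; split.
    apply: L_ge bd _; apply: filterS diff_small => F.
    by rewrite ler_norml => /andP[].
  apply: L_le bd _; apply: filterS diff_small => F.
  by rewrite ler_norml => /andP[].
Qed.

End MeanFromMatchings.

(** * Drift of Lipschitz functions *)

Section LipschitzFunctions.
Variables (R : realType) (G : topologicalGroupType) (d : G -> G -> R).
Hypothesis d_pseudo : pseudometric d.

Definition lip01 : set (G -> R) :=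
  [set f | (forall x, 0 <= f x <= 1) /\ forall x y, f x - f y <= d x y].

Lemma lip01_0 : lip01 (fun=> 0).
Proof.
have [_ d0 _ _] := d_pseudo.
by split=> [x|x y]; rewrite ?lexx ?ler01// subr0.
Qed.

Lemma lip01_lucb f : left_uniform_pseudometric d -> lip01 f -> f \in @lucb R G.
Proof.
have [_ _ dC _] := d_pseudo.
move=> dU [f01 fd]; apply/lucbP; split.
  apply/Defs.bounded_funP; exists 1 => x.
  by have /andP[f0 f1] := f01 x; rewrite ger0_norm.
move=> e /dU[U U1 Ud]; exists U => // x y /Ud dxy.
have := fd x y; have := fd y x; rewrite (dC y x) => ? ?.
by rewrite ler_norml; apply/andP; split; lra.
Qed.

(** The function is the maximum over [a] in [s] of [1 - d a y] and [0].  Its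
    modulus of continuity does not depend on [s]. *)
Lemma lip01_bump (s : seq G) : exists2 f, lip01 f &
  {in s, forall a, f a = 1} /\
  forall y, {in s, forall a, 1 <= d a y} -> f y = 0.
Proof.
have [dxx d0 dC dT] := d_pseudo.
elim: s => [|a s [f [f01 fd] [f1 f0]]].
  by exists (fun=> 0) => //; exact: lip01_0.
exists (fun y => Num.max (1 - d a y) (f y)); first split.
- move=> x; have /andP[? ?] := f01 x; have := d0 a x.
  by rewrite le_max ge_max; lra.
- move=> x y; have fxy := fd x y; have dxy := dT a x y; have dxy0 := d0 x y.
  by case: (leP (1 - d a x)) => ?; case: (leP (1 - d a y)) => ?; lra.
- split=> [b|y sy].
    rewrite inE => /predU1P[->|/f1 fb].
      by rewrite dxx subr0; have /andP[_ /max_l] := f01 a.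
    by rewrite fb max_r// gerBl.
  rewrite f0 => [|b bs]; last by apply: sy; rewrite inE bs orbT.
  by rewrite max_r// subr_le0 sy// mem_head.
Qed.

Lemma lip01_average (n : nat) (f : nat -> G -> R) : (0 < n)%N ->
  (forall t, lip01 (f t)) -> lip01 (fun x => (\sum_(t < n) f t x) / n%:R).
Proof.
move=> n0 lipf; have n0' : 0 < n%:R :> R by rewrite ltr0n.
split=> [x|x y].
  rewrite divr_ge0 ?ler0n ?sumr_ge0//=; last first.
    by move=> t _; have [/(_ x)/andP[]] := lipf t.
  rewrite ler_pdivrMr// mul1r -[n in leRHS]card_ord -sumr_const.
  by apply: ler_sum => t _; have [/(_ x)/andP[]] := lipf t.
rewrite -mulrBl ler_pdivrMr// -sumrB mulr_natr.
rewrite -[n in leRHS]card_ord -sumr_const.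
by apply: ler_sum => t _; have [_] := lipf t.
Qed.

End LipschitzFunctions.

Section ApproximateMatchings.
Variables (R : realType) (G : topologicalGroupType).

(** At least [r] of the members of the family [x] are matched within [W] to
    members of its translate by [g].  Matching indices rather than points
    keeps track of multiplicities. *)
Definition index_matching (W : set G) n (x : 'I_n -> G) (g : G) (r : R) :=
  exists (D : {set 'I_n}) (f : 'I_n -> 'I_n),
    [/\ {in D &, injective f},
        forall i, i \in D -> W ((x i)^-1 * (g * x (f i)))%g &
        r <= #|D|%:R].

Section Obstruction.
Variables (W : set G) (d : G -> G -> R).
Hypothesis d_pseudo : pseudometric d.
Hypothesis d_W : forall x y, d x y < 1 -> W (x^-1 * y)%g.

(** Failure of the matching violates Hall's condition at some set [S] of
    indices; take the bump around the [x i], [i] in [S].  It vanishes at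
    [g x_j] unless [j] is a neighbor of [S], since points at [d]-distance less
    than [1] differ by an element of [W]. *)
Lemma index_matching_obstruction n (x : 'I_n -> G) (g : G) (eta : R) :
    0 <= eta -> ~ index_matching W x g ((1 - eta) * n%:R) ->
  exists2 f, lip01 d f & eta * n%:R <= \sum_i (f (x i) - f (g * x i)%g).
Proof.
move=> eta0 nomatch; have [n0|n0] := posnP n.
  subst n; exists (fun=> 0); first exact: lip01_0.
  by rewrite mulr0 sumr_ge0// => i _; rewrite subrr.
pose N i : {set 'I_n} := [set j | `[< W ((x i)^-1 * (g * x j))%g >]]%SET.
pose k := Num.truncn (eta * n%:R).
have /andP[k1 k2] := truncn_itv (mulr_ge0 eta0 (ler0n R n)).
have [S ltS] : exists S : {set 'I_n}, (#|neighbors N S| + k < #|S|)%N.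
  apply: contrapT => noS; apply: nomatch.
  have [|D [f [injf fN cD]]] := @hall_deficiency _ _ (Ordinal n0) k N.
    by move=> S; rewrite leqNgt; apply/negP => ltS; apply: noS; exists S.
  exists D, f; split => //.
    by move=> i /fN; rewrite inE => /asboolP.
  move: cD; rewrite card_ord -(ler_nat R) natrD -/k; lra.
have [f lipf [f1 f0]] := lip01_bump d_pseudo [seq x i | i <- enum S].
exists f => //; have [f01 _] := lipf.
have leS : #|S|%:R <= \sum_i f (x i).
  rewrite -sumr_const big_mkcond; apply: ler_sum => i _.
  case: ifP => iS; last by have /andP[] := f01 (x i).
  by rewrite f1// map_f// mem_enum.
have leN : \sum_i f (g * x i)%g <= #|neighbors N S|%:R.
  rewrite -sumr_const [leRHS]big_mkcond; apply: ler_sum => j _.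
  case: ifPn => jN; first by have /andP[] := f01 (g * x j)%g.
  rewrite f0// => a /mapP[i]; rewrite mem_enum => iS ->.
  rewrite leNgt; apply/negP => /d_W Wij; move/negP: jN; apply.
  by apply/bigcupP; exists i => //; rewrite inE; apply/asboolP.
rewrite sumrB; move: ltS; rewrite -(ler_nat R) -addn1 !natrD => ltS.
rewrite -natr1 in k2; lra.
Qed.

End Obstruction.
End ApproximateMatchings.

(** Natural weights on a finite set are the same as a family of points with
    multiplicities. *)
Lemma sum_multiset (R : realType) (T : choiceType) (x0 : T) (A : {fset T})
    (w : A -> nat) (s := flatten [seq nseq (w a) (val a) | a <- enum {: A}])
    (phi : T -> R) :
  \sum_(i < size s) phi (nth x0 s i) = \sum_a (w a)%:R * phi (val a).
Proof.
rewrite -(big_mkord xpredT (fun i => phi (nth x0 s i))) -(big_nth x0 xpredT).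
rewrite big_flatten big_map big_enum /=; apply: eq_bigr => a _.
by rewrite big_nseq iter_addr_0 mulr_natl.
Qed.

Section Minimax.
Variables (R : realType) (G : topologicalGroupType).
Variables (W : set G) (d : G -> G -> R) (E : {fset G}) (eta : R).
Hypothesis d_pseudo : pseudometric d.
Hypothesis d_W : forall x y, d x y < 1 -> W (x^-1 * y)%g.
Hypothesis eta_gt0 : 0 < eta.
Hypothesis no_matching : forall n (x : 'I_n -> G), (0 < n)%N ->
  exists2 g, g \in E & ~ index_matching W x g ((1 - eta) * n%:R).

(** For [F h] in [LUCB(G)] this is a function of [a] that every mean
    invariant under left translations sends to [0]. *)
Definition total_drift (F : G -> G -> R) (a : G) : R :=
  \sum_(h <- E) (F h a - F h (h * a)%g).

Definition lip01_family : set (G -> G -> R) :=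
  [set F | forall h, lip01 d (F h)].

Lemma lip01_family_range F h x : lip01_family F -> 0 <= F h x <= 1.
Proof. by move=> /(_ h)[]. Qed.

Lemma lip01_dist (f : G -> R) x y : lip01 d f -> `|f x - f y| <= 1.
Proof.
move=> [f01 _]; have /andP[? ?] := f01 x; have /andP[? ?] := f01 y.
by rewrite ler_norml; apply/andP; split; lra.
Qed.

Lemma total_drift_bounded F a : lip01_family F ->
  `|total_drift F a| <= #|` E|%:R.
Proof.
move=> lipF; rewrite -[leRHS]mul1r.
by apply: ler_norm_sum_fset => h _; exact: lip01_dist.
Qed.

(** Only the coordinate of the translation [g] that obstructs the family
    carries a nonzero function. *)
Lemma weighted_drift (A : {fset G}) (w : A -> nat) :
  exists2 F, lip01_family F &
    eta * \sum_a (w a)%:R <= \sum_a (w a)%:R * total_drift F (val a).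
Proof.
pose s := flatten [seq nseq (w a) (val a) | a <- enum {: A}].
have sizeE : (size s)%:R = \sum_a (w a)%:R :> R.
  have := sum_multiset 1%g w (fun=> 1 : R).
  rewrite sumr_const card_ord => ->.
  by apply: eq_bigr => a _; rewrite mulr1.
rewrite -sizeE; have [s0|s0] := posnP (size s).
  exists (fun _ _ => 0); first by move=> h; exact: lip01_0.
  rewrite s0 mulr0 sumr_ge0// => a _.
  by rewrite /total_drift big1 ?mulr0// => h _; rewrite subrr.
have [g gE nomatch] := no_matching (fun i => nth 1%g s i) s0.
have [f lipf leS] :=
  index_matching_obstruction d_pseudo d_W (ltW eta_gt0) nomatch.
exists (fun h => if h == g then f else fun=> 0).
  by move=> h; case: ifP => _ //; exact: lip01_0.
apply: le_trans leS _.
rewrite (sum_multiset 1%g w (fun y => f y - f (g * y)%g)).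
apply: ler_sum => a _; rewrite /total_drift (big_fsetD1 g)//= eqxx.
rewrite big1_fset ?addr0// => h; rewrite !inE => /andP[/negbTE -> _] _.
by rewrite subrr.
Qed.

(** Averages over time of the answers in [approachability] stay in the set of
    tuples, by convexity. *)
Lemma finite_drift (A : {fset G}) : exists2 F, lip01_family F &
  forall a, a \in A -> eta / 2 <= total_drift F a.
Proof.
have [s lips sP] := approachability
  (fun F (a : A) => @total_drift_bounded F (val a)) (@weighted_drift A).
have e2 : 0 < eta / 2 by rewrite divr_gt0.
have [n n0 sn] := sP _ e2.
have n0' : 0 < n%:R :> R by rewrite ltr0n.
exists (fun h x => (\sum_(t < n) s t h x) / n%:R).
  move=> h; apply: (lip01_average n0 (f := fun t => s t h)) => t; exact: lips.
move=> a aA; have := sn [` aA]%fset; rewrite [val _]/=.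
rewrite (_ : eta - eta / 2 = eta / 2); last by lra.
rewrite -ler_pdivlMr// => /le_trans; apply; rewrite le_eqVlt; apply/orP; left.
apply/eqP; rewrite /total_drift exchange_big/= mulr_suml; apply: eq_bigr => h _.
by rewrite sumrB mulrBl.
Qed.

(** Tuples with large drift on larger and larger finite sets have a pointwise
    limit along an ultrafilter.  The bounds that define [lip01_family] are
    closed conditions, and each value of the drift involves finitely many
    values of the functions. *)
Lemma uniform_drift : exists2 F, lip01_family F &
  forall a, eta / 2 <= total_drift F a.
Proof.
have /choice[F FP] : forall A : {fset G}, exists F, lip01_family F /\
    forall a, a \in A -> eta / 2 <= total_drift F a.
  by move=> A; have [F lipF FA] := finite_drift A; exists F.
pose upper := filter_from [set: {fset G}] (fun A => [set B | (A `<=` B)%fset]).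
have upper_proper : ProperFilter upper.
  apply: filter_from_proper; last by move=> A _; exists A => /=.
  apply: filter_from_filter; first by exists fset0.
  move=> A B _ _; exists (A `|` B)%fset => // C /=.
  by rewrite fsubUset => /andP[].
have [L [L_lin L_ge L_le]] := @ultralimit R _ _ upper_proper.
have F1 h x A : `|F A h x| <= 1.
  have [/(lip01_family_range h x)/andP[f0 f1] _] := FP A.
  by rewrite ger0_norm.
have LB (u v : {fset G} -> R) M N :
    (forall A, `|u A| <= M) -> (forall A, `|v A| <= N) ->
    L (fun A => u A - v A) = L u - L v.
  move=> uM vN; rewrite addrC -mulN1r -(L_lin _ _ _ _ _ vN uM).
  by congr L; apply/funext => A; rewrite mulN1r addrC.
have L0 : L (fun=> 0) = 0.
  have b0 (A : {fset G}) : `|0 : R| <= 0 by rewrite normr0.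
  by have := LB _ _ _ _ b0 b0; rewrite !subrr.
exists (fun h x => L (fun A => F A h x)).
  move=> h; split=> [x|x y].
    apply/andP; split.
      apply: (L_ge _ _ _ (F1 h x)); apply: filterE => A.
      by have [/(lip01_family_range h x)/andP[]] := FP A.
    apply: (L_le _ _ _ (F1 h x)); apply: filterE => A.
    by have [/(lip01_family_range h x)/andP[]] := FP A.
  rewrite -(LB _ _ _ _ (F1 h x) (F1 h y)).
  apply: (L_le _ 1); last by apply: filterE => A; have [/(_ h)[]] := FP A.
  by move=> A; have [/(_ h) lipF _] := FP A; exact: lip01_dist.
move=> a; suff -> : total_drift (fun h x => L (fun A => F A h x)) a =
    L (fun A => total_drift (F A) a).
  apply: (L_ge _ #|` E|%:R).
    by move=> A; have [lipF _] := FP A; exact: total_drift_bounded.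
  exists [fset a]%fset => // A /= aA; have [_] := FP A; apply.
  by rewrite -fsub1set.
rewrite /total_drift; elim: (E : seq G) => [|h s IH].
  by rewrite big_nil; under eq_fun do rewrite big_nil; rewrite L0.
rewrite big_cons IH -(LB _ _ _ _ (F1 h a) (F1 h (h * a)%g)).
have b1 A : `|F A h a - F A h (h * a)%g| <= 1.
  by have [/(_ h) lipF _] := FP A; exact: lip01_dist.
have bs A : `|\sum_(k <- s) (F A k a - F A k (k * a)%g)| <= (size s)%:R.
  rewrite (le_trans (ler_norm_sum _ _ _))// -sum1_size natr_sum.
  by apply: ler_sum => k _; have [/(_ k) lipF _] := FP A; exact: lip01_dist.
have := L_lin 1 _ _ _ _ b1 bs; rewrite mul1r => <-.
by congr L; apply/funext => A; rewrite big_cons mul1r.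
Qed.

End Minimax.

Section ApproximateMatchingsFromMean.
Variables (R : realType) (G : topologicalGroupType).

(** Each term has mean [0] by invariance; the sum is built inside [LUCB(G)],
    where the mean is linear. *)
Lemma invariant_drift (mu : {scalar LUCB R G}) (F : G -> LUCB R G) (s : seq G) :
    (forall (f : LUCB R G) g, mu (LUCB_lambda g f) = mu f) ->
  exists2 u : LUCB R G, mu u = 0 &
    forall x, u x = \sum_(h <- s) (F h x - F h (h * x)%g).
Proof.
move=> mu_inv; elim: s => [|h s [u mu_u uE]].
  by exists 0; [rewrite linear0|move=> x; rewrite big_nil].
exists (F h - LUCB_lambda h (F h) + u).
  by rewrite linearD linearB/= mu_inv subrr add0r.
by move=> x; rewrite big_cons -uE.
Qed.

(** Otherwise [uniform_drift] provides a drift that is at least [eta / 2]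
    everywhere, whereas the mean of a drift is [0]. *)
Lemma skew_amenable_index_matching (W : set G) (E : {fset G}) (eta : R) :
    skew_amenable R G -> nbhs (1%g : G) W -> 0 < eta ->
  exists n (x : 'I_n -> G), (0 < n)%N /\
    forall g, g \in E -> index_matching W x g ((1 - eta) * n%:R).
Proof.
move=> [mu [mu_ge0 mu1] mu_inv] W1 eta0; apply: contrapT => nomatch.
have [d [d_pseudo d_unif d_W]] := left_pseudometric R W1.
have [|F lipF Fge] := @uniform_drift R G W d E eta d_pseudo d_W eta0.
  move=> n x n0; apply: contrapT => noobs; apply: nomatch.
  exists n, x; split => // g gE.
  by apply: contrapT => nog; apply: noobs; exists g.
pose f h := MkLUCB (lip01_lucb d_pseudo d_unif (lipF h)).
have [u mu_u uE] := invariant_drift f E mu_inv.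
have : 0 <= mu (u - (eta / 2) *: LUCB1 R G).
  apply: mu_ge0 => x; have := Fge x; rewrite /total_drift -uE /= => ux.
  by change (0 <= u x - eta / 2 * 1); rewrite mulr1 subr_ge0.
rewrite linearB linearZ/= mu_u mu1 mulr1; lra.
Qed.

End ApproximateMatchingsFromMean.

(** * From families to sets *)

Section InfiniteNeighborhoods.
Variables (R : realType) (G : topologicalGroupType).

Lemma spread_seq (V : set G) (s : seq G) : infinite_set V ->
  exists t, [/\ size t = size s, uniq t &
    forall i, (i < size s)%N -> V ((nth 1%g s i)^-1 * nth 1%g t i)%g].
Proof.
move=> infV; elim: s => [|a s [t [st ut Vt]]]; first by exists [::].
have [v Vv vt] : exists2 v, V v & (a * v)%g \notin t.
  apply: contrapT => nov; apply: infV.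
  apply: (sub_finite_set _ (finite_seq [seq (a^-1 * y)%g | y <- t])) => v Vv /=.
  apply: contrapT => vt; apply: nov; exists v => //.
  by apply/negP => avt; apply: vt; apply/mapP; exists (a * v)%g; rewrite ?mulKg.
exists ((a * v)%g :: t); split => /=; rewrite ?st ?vt//.
by case=> [_|i /Vt//] /=; rewrite mulKg.
Qed.

(** Replace [x i] by distinct [y i] with [(x i)^-1 * y i] small.  Then
    [(y i)^-1 * (g * y j)] differs from [(x i)^-1 * (g * x j)] by a small
    factor on each side, whatever [g] is. *)
Lemma index_matching_infinite (U : set G) : nbhs (1%g : G) U ->
    (forall V, nbhs (1%g : G) V -> infinite_set V) ->
  exists2 W, nbhs (1%g : G) W &
    forall n (x : 'I_n -> G), (0 < n)%N -> exists2 F : {fset G}, F != fset0 &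
      forall (r : R) g, index_matching W x g (r * n%:R) ->
        r * #|` F|%:R <= (matchnum F (fset_lmul g F) U)%:R.
Proof.
move=> /nbhs1_mulg[A A1 AU] inf; have [B B1 BA] := nbhs1_mulg A1.
exists B => // n x n0.
pose V := B `&` [set v | A v^-1%g].
have V1 : nbhs (1%g : G) V by apply: filterI => //; exact: nbhs1_invg.
have [t [st ut Vt]] := spread_seq [seq x i | i <- enum 'I_n] (inf V V1).
rewrite size_map size_enum_ord in st Vt.
pose y (i : 'I_n) := nth 1%g t i.
have injy : injective y.
  by move=> i j /eqP; rewrite nth_uniq ?st// => /eqP/val_inj.
have xy i : V ((x i)^-1 * y i)%g.
  have := Vt i (ltn_ord i).
  by rewrite (nth_map i) ?size_enum_ord// nth_ord_enum.
have cF : #|` [fset y i | i in 'I_n]%fset| = n.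
  by rewrite card_imfset//= -cardE card_ord.
exists [fset y i | i in 'I_n]%fset => [|r g [D [f [injf fW rD]]]].
  by rewrite -cardfs_gt0 cF.
rewrite cF (le_trans rD)// ler_nat.
apply: (matchnum_ge_family (a := y) (b := fun i => (g * y (f i))%g)).
- by move=> i j _ _; exact: injy.
- by move=> i j iD jD /mulgI/injy; exact: injf.
- move=> i iD; split; first by apply/imfsetP; exists i.
    by apply/imfsetP; exists (y (f i)) => //; apply/imfsetP; exists (f i).
  have -> : ((y i)^-1 * (g * y (f i)))%g =
      (((x i)^-1 * y i)^-1 *
        (((x i)^-1 * (g * x (f i))) * ((x (f i))^-1 * y (f i))))%g.
    by rewrite invgM invgK -!mulgA !mulVKg.
  apply: AU; first by have [] := xy i.
  by apply: BA; [exact: fW|have [] := xy (f i)].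
Qed.

End InfiniteNeighborhoods.

Section FiniteNeighborhood.
Variables (R : realType) (G : topologicalGroupType).

(** A finite neighborhood that is not contained in [U] shrinks when intersected
    with [U], and this can happen only finitely often. *)
Lemma finite_smallest_nbhs (V : set G) : nbhs (1%g : G) V -> finite_set V ->
  exists2 N : {fset G}, nbhs (1%g : G) [set` N] &
    forall U, nbhs (1%g : G) U -> [set` N] `<=` U.
Proof.
move=> V1 /finite_fsetP[N VN]; rewrite {V}VN in V1.
have [m] := ubnP #|` N|; elim: m N V1 => // m IH N N1 ltm.
have [minN|] := pselect (forall U, nbhs (1%g : G) U -> [set` N] `<=` U).
  by exists N.
move=> /existsNP[U /not_implyP[U1 /existsNP[x /not_implyP[/= xN nUx]]]].
apply: (IH [fset y in N | `[< U y >]]%fset).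
  apply: filterS (filterI N1 U1) => y [/= yN Uy].
  by rewrite !inE /= yN; apply/asboolP.
apply: leq_trans (ltm : (_ <= m)%N); apply: fproper_ltn_card.
rewrite fproperE; apply/andP; split.
  by apply/fsubsetP => y; rewrite !inE => /andP[].
apply/negP => /fsubsetP/(_ x xN); rewrite !inE /= xN => /asboolP.
exact: nUx.
Qed.

Lemma sum_ltn (m n : nat) : (m <= n)%N -> (\sum_(k < n) (k < m) = m)%N.
Proof.
move=> mn; rewrite -[RHS](minn_idPl mn).
elim: n {mn} => [|n IH]; first by rewrite big_ord0 minn0.
by rewrite big_ord_recr /= IH; lia.
Qed.

Lemma card_fset_filter (S : {fset G}) (P : pred G) :
  #|` [fset y in S | P y]%fset| = (\sum_(y <- S) P y)%N.
Proof.
rewrite -sum1_size big_fset/= [RHS]big_mkcond/= big_mkcond/=.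
by apply: eq_bigr => y _; case: (P y).
Qed.

(** [N] is a subgroup: by minimality it is contained in the neighborhoods that
    continuity of the product and of the inverse provide for [N] itself.  Let
    [c y] count the [x i] in the coset [y N] and [F k] be the set where
    [c > k].  The cardinals [#|F k|] add up to [n #|N|], and those of the
    [F k :&: g F k] to the sum of the minima of [c y] and [c (g^-1 y)], which
    is at least [#|N|] times the number of matched indices.  The defects
    [#|F k| - #|F k :&: g F k|], added over [g] in [E], are therefore small
    in total, hence small for some nonempty [F k]. *)
Lemma index_matching_finite (N : {fset G}) n (x : 'I_n -> G) (E : {fset G})
    (theta : R) :
    (forall U, nbhs (1%g : G) U -> [set` N] `<=` U) ->
    nbhs (1%g : G) [set` N] -> (0 < n)%N ->
    (forall g, g \in E -> index_matching [set` N] x g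
      ((1 - (1 - theta) / #|` E|.+1%:R) * n%:R)) ->
    theta < 1 ->
  exists2 F : {fset G}, F != fset0 & forall g, g \in E ->
    theta * #|` F|%:R <= (matchnum F (fset_lmul g F) [set` N])%:R.
Proof.
move=> minN N1 n0 matchE theta1.
have NM y z : y \in N -> z \in N -> (y * z)%g \in N.
  move=> yN zN; have [V V1] := nbhs1_mulg N1; apply; exact: minN V1 _ _.
have NV y : y \in N -> (y^-1)%g \in N.
  by move=> yN; exact: (minN _ (nbhs1_invg N1) y).
have N_1 : 1%g \in N by exact: nbhs_singleton N1.
pose P i y : bool := ((x i)^-1 * y)%g \in N.
pose c y : nat := (\sum_i P i y)%N.
pose S := [fset (x i * v)%g | i in 'I_n, v in N]%fset.
have PS i y : P i y -> y \in S.
  move=> Piy; apply/imfset2P; exists i => //.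
  by exists ((x i)^-1 * y)%g; rewrite ?mulVKg.
have count (D : {set 'I_n}) :
    (\sum_(y <- S) \sum_(i in D) P i y = #|D| * #|` N|)%N.
  rewrite exchange_big /= -sum_nat_const; apply: eq_bigr => i _.
  rewrite -card_fset_filter.
  have -> : [fset y in S | P i y]%fset = [fset (x i * v)%g | v in N]%fset.
    apply/fsetP => y; apply/idP/imfsetP => [|[v /= vN ->]].
      rewrite !inE => /andP[_ Piy].
      by exists ((x i)^-1 * y)%g; rewrite ?mulVKg.
    have Pv : P i (x i * v)%g by rewrite /P mulKg.
    by rewrite !inE /= (PS i)// Pv.
  by rewrite card_imfset //=; exact: mulgI.
have c_le y : (c y <= n)%N.
  rewrite -[leqRHS]card_ord -sum1_card; apply: leq_sum => i _.
  by case: (P i y).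
pose F k := [fset y in S | (k < c y)%N]%fset.
(* Contained in [F k :&: g F k], whose points are matched to themselves. *)
pose H g k := [fset y in S | (k < minn (c y) (c (g^-1 * y)%g))%N]%fset.
have cardF k : #|` F k| = (\sum_(y <- S) (k < c y))%N.
  exact: card_fset_filter.
have cardH g k :
    #|` H g k| = (\sum_(y <- S) (k < minn (c y) (c (g^-1 * y)%g)))%N.
  exact: card_fset_filter.
have HF g k : (#|` H g k| <= matchnum (F k) (fset_lmul g (F k)) [set` N])%N.
  apply/matchnum_geP; exists (H g k), id; split=> //.
    by apply/fsubsetP => y; rewrite !inE /= leq_min => /and3P[-> ->].
  move=> y; rewrite !inE /= leq_min => /and3P[yS ky kgy]; split.
    apply/imfsetP; exists (g^-1 * y)%g; last by rewrite mulVKg.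
    rewrite !inE /= kgy andbT.
    have : c (g^-1 * y)%g != 0%N by rewrite -lt0n; exact: leq_ltn_trans kgy.
    rewrite sum_nat_eq0 negb_forall => /existsP[i].
    by rewrite eqb0 negbK => /PS.
  by rewrite mulVg.
have sumF : (\sum_(k < n) #|` F k| = n * #|` N|)%N.
  transitivity (\sum_(y <- S) c y)%N.
    rewrite (eq_bigr _ (fun (k : 'I_n) _ => cardF k)).
    rewrite exchange_big /=; apply: eq_bigr => y _; exact: sum_ltn.
  have := count [set: 'I_n]%SET; rewrite cardsT card_ord => <-.
  by apply: eq_bigr => y _; apply: eq_bigl => i; rewrite inE.
(* In each coset the matched indices inject into those of its translate. *)
have sumH g (r : R) : index_matching [set` N] x g r ->
    r * #|` N|%:R <= (\sum_(k < n) #|` H g k|)%:R.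
  move=> [D [f [injf fN rD]]].
  apply: (@le_trans _ _ (#|D| * #|` N|)%:R); first by rewrite natrM ler_wpM2r.
  rewrite ler_nat -count.
  rewrite [leqRHS](eq_bigr _ (fun (k : 'I_n) _ => cardH g k)).
  rewrite [leqRHS]exchange_big /=; apply: leq_sum => y _.
  rewrite sum_ltn; last by rewrite geq_min c_le.
  rewrite leq_min; apply/andP; split.
    rewrite /c [leqRHS](bigID (mem D)) /=; exact: leq_addr.
  apply: (@leq_trans (\sum_(j in f @: D) P j (g^-1 * y)%g)%N).
    rewrite big_imset//=; apply: leq_sum => i iD.
    case Piy : (P i y) => //; rewrite lt0b /P.
    have -> : ((x (f i))^-1 * (g^-1 * y))%g =
        (((x i)^-1 * (g * x (f i)))^-1 * ((x i)^-1 * y))%g.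
      by rewrite !invgM invgK -!mulgA !mulVKg.
    by apply: NM => //; apply: NV; exact: fN.
  rewrite /c [leqRHS](bigID (mem (f @: D))) /=; exact: leq_addr.
apply: contrapT => noF.
have bad k : F k != fset0 -> exists2 g, g \in E &
    #|` H g k|%:R < theta * #|` F k|%:R.
  move=> Fk0; apply: contrapT => nog; apply: noF; exists (F k) => // g gE.
  apply: (@le_trans _ _ #|` H g k|%:R); last by rewrite ler_nat HF.
  by rewrite leNgt; apply/negP => lt; apply: nog; exists g.
have HleF g k : #|` H g k|%:R <= #|` F k|%:R :> R.
  rewrite ler_nat fsubset_leq_card//.
  by apply/fsubsetP => y; rewrite !inE /= leq_min => /and3P[-> ->].
pose defect k : R := \sum_(g <- E) (#|` F k|%:R - #|` H g k|%:R).
have defect_ge k : F k != fset0 -> (1 - theta) * #|` F k|%:R < defect k.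
  move=> /bad[g gE lt]; rewrite /defect (big_fsetD1 g)//=.
  have : 0 <= \sum_(h <- (E `\ g)%fset) (#|` F k|%:R - #|` H h k|%:R) :> R.
    by rewrite sumr_ge0// => h _; rewrite subr_ge0.
  lra.
have N0 : 0 < #|` N|%:R :> R.
  by rewrite ltr0n cardfs_gt0; apply/fset0Pn; exists 1%g.
have n0' : 0 < n%:R :> R by rewrite ltr0n.
have eta0 : 0 < 1 - theta by rewrite subr_gt0.
have total : \sum_(k < n) defect k <= (1 - theta) * (n%:R * #|` N|%:R).
  rewrite /defect exchange_big /=.
  apply: (@le_trans _ _ (\sum_(g <- E)
      ((1 - theta) / #|` E|.+1%:R * (n%:R * #|` N|%:R)))).
    rewrite big_seq [leRHS]big_seq; apply: ler_sum => g gE.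
    rewrite sumrB -!natr_sum sumF natrM.
    by have := sumH g _ (matchE g gE); set q := (_ / _); lra.
  rewrite big_const_seq count_predT iter_addr_0 -[X in X <= _]mulr_natr.
  rewrite mulrAC ler_pM2r ?mulr_gt0// mulrAC ler_pdivrMr ?ltr0Sn//.
  by rewrite ler_pM2l// ler_nat.
have : (1 - theta) * (n%:R * #|` N|%:R) < \sum_(k < n) defect k.
  rewrite -natrM -sumF natr_sum mulr_sumr.
  have [k0 Fk0] : exists k : 'I_n, F k != fset0.
    apply: contrapT => allF0; have : (0 < n * #|` N|)%N.
      by rewrite muln_gt0 n0 -(ltr0n R).
    rewrite -sumF big1// => k _; apply/eqP; rewrite cardfs_eq0.
    by apply: contrapT => /negP Fk; apply: allF0; exists k.
  rewrite (bigD1 k0)//= [ltRHS](bigD1 k0)//=.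
  apply: ltr_leD; first exact: defect_ge.
  apply: ler_sum => k _; have [->|/defect_ge/ltW//] := eqVneq (F k) fset0.
  by rewrite cardfs0 mulr0 sumr_ge0// => g _; rewrite subr_ge0.
by rewrite ltNge total.
Qed.

End FiniteNeighborhood.

(** * The characterization *)

Lemma skew_amenable_has_matchings (R : realType) (G : topologicalGroupType) :
  skew_amenable R G -> has_matchings R G.
Proof.
move=> sam theta U E /andP[theta0 theta1] U1.
have eta0 : 0 < 1 - theta by rewrite subr_gt0.
have [inf|] := pselect (forall V, nbhs (1%g : G) V -> infinite_set V).
  have [W W1 WU] := index_matching_infinite R U1 inf.
  have [n [x [n0 xP]]] := skew_amenable_index_matching E sam W1 eta0.
  have [F F0 FP] := WU n x n0; exists F => // g /xP; rewrite subKr.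
  exact: FP.
move=> /existsNP[V /not_implyP[V1 /contrapT finV]].
have [N N1 minN] := finite_smallest_nbhs V1 finV.
have eta1 : 0 < (1 - theta) / #|` E|.+1%:R by rewrite divr_gt0.
have [n [x [n0 xP]]] := skew_amenable_index_matching E sam N1 eta1.
have [F F0 FP] := index_matching_finite minN N1 n0 xP theta1.
exists F => // g /FP /le_trans; apply; rewrite ler_nat.
exact: matchnumS (minN U U1).
Qed.

Theorem theorem5p5 (R : realType) (G : topologicalGroupType) :
  skew_amenable R G <->
  (forall (theta : R) (U : set G) (E : {fset G}),
     0 <= theta < 1 -> nbhs (1%g : G) U ->
     exists2 F : {fset G}, F != fset0 &
       forall g : G, g \in E ->
         theta * (#|` F|)%:R <= (matchnum F (fset_lmul g F) U)%:R).
Proof.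
split; first exact: skew_amenable_has_matchings.
exact: has_matchings_skew_amenable.
Qed.
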